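(* Let $R$ be a commutative ring with identity. (a) If $R$ has a $\prec$-minimal generator, then the topological space $\operatorname{spec}(R)$ has a $\prec$-minimal open cover. (b) If $\alpha\colon R\to R$ is an expansive automorphism, then $\operatorname{spec}(\alpha)\colon\operatorname{spec}(R)\to\operatorname{spec}(R)$ is an expansive homeomorphism. (c) If $\alpha\colon R\to R$ is a positively expansive automorphism, then $\operatorname{spec}(\alpha^{-1})\colon\operatorname{spec}(R)\to\operatorname{spec}(R)$ is a positively expansive homeomorphism.
   Context: For families of sets, $\mathcal A\prec\mathcal B$ means that for every $A\in\mathcal A$ there is $B\in\mathcal B$ with $A\subseteq B$. Algebraic notions. A generator of $R$ is a finite set $\mathcal I$ of ideals of $R$ with $\sum_{I\in\mathcal I}I=R$; it is $\prec$-minimal if $\mathcal I\prec\mathcal J$ for every generator $\mathcal J$. The product of generators is $\mathcal I\mathcal J=\{IJ\mid I\in\mathcal I,\,J\in\mathcal J\}$, and similarly for finitely many factors. For an automorphism $\alpha$ of $R$ and $i\in\mathbb Z$, $\alpha^{i}(\mathcal I)=\{\alpha^{i}(I)\mid I\in\mathcal I\}$. The automorphism $\alpha$ is expansive (resp. positively expansive) if there is a generator $\mathcal I$ such that for every generator $\mathcal J$ there is $N\ge0$ with $\prod_{|i|\le N}\alpha^{-i}(\mathcal I)\prec\mathcal J$ (resp. $\prod_{i=0}^N\alpha^{-i}(\mathcal I)\prec\mathcal J$). Topological notions. Let $X$ be a compact (not necessarily Hausdorff) topological space; open covers are assumed finite. For open covers $\mathcal U_1,\dots,\mathcal U_n$,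 $\bigwedge_{i=1}^n\mathcal U_i$ is the family of all intersections $U_1\cap\dots\cap U_n$ with $U_i\in\mathcal U_i$. For a homeomorphism $h$ of $X$ and $i\in\mathbb Z$, $h^{i}(\mathcal U)=\{h^{i}(U)\mid U\in\mathcal U\}$. An open cover $\mathcal U$ is $\prec$-minimal if $\mathcal U\prec\mathcal V$ for every open cover $\mathcal V$. A homeomorphism $h\colon X\to X$ is expansive (resp. positively expansive) if there is an open cover $\mathcal U$ such that for every open cover $\mathcal V$ there is $N\ge0$ with $\bigwedge_{|i|\le N}h^{-i}(\mathcal U)\prec\mathcal V$ (resp. $\bigwedge_{i=0}^Nh^{-i}(\mathcal U)\prec\mathcal V$). Spectrum. $\operatorname{spec}(R)$ is the set of prime ideals of $R$ with the Zariski topology, whose open sets are the sets $U_I$ of prime ideals not containing a given ideal $I$; for an automorphism $\alpha$ of $R$, $\operatorname{spec}(\alpha)(\mathfrak p)=\alpha^{-1}(\mathfrak p)$. *)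

(* Defs.v *)
From HB Require Import structures.
From mathcomp Require Import all_boot all_order all_algebra.
From mathcomp Require Import all_classical topology.

Set Implicit Arguments.
Unset Strict Implicit.
Unset Printing Implicit Defensive.

Import GRing.Theory.
Local Open Scope classical_set_scope.
Local Open Scope ring_scope.

Definition prec (T : Type) (A B : set (set T)) : Prop :=
  forall X, A X -> exists2 Y, B Y & X `<=` Y.

(* The image of A under the i-th iterate of a bijection f; the negative
   iterates of f enter through the preimages of the positive ones, so that no
   inverse function is needed.  Only meaningful when f is bijective. *)
Definition zimage (T : Type) (f : T -> T) (i : int) (A : set T) : set T :=
  match i with
  | Posz n => iter n f @` A
  | Negz n => iter n.+1 f @^-1` A
  end.

(* The integers i with |i| <= N. *)
Definition int_range (N : nat) : seq int :=
  [seq k%:Z - N%:Z | k <- iota 0 (N.*2).+1].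

Section Algebra.
Variable R : comPzRingType.

(* Unlike the ideals of ring_quotient, these may contain 1. *)
Definition ideal (I : set R) : Prop :=
  [/\ I 0, (forall x y, I x -> I y -> I (x + y))
    & (forall a x, I x -> I (a * x))].

Definition prime_ideal (p : set R) : Prop :=
  [/\ ideal p, ~ p 1 & forall a b, p (a * b) -> p a \/ p b].

(* The sum of the ideals belonging to a finite family F. *)
Definition ideal_sum (F : set (set R)) : set R :=
  [set r | exists2 x : set R -> R,
             (forall I, F I -> I (x I)) & r = \sum_(I \in F) x I].

Definition ideal_mul (I J : set R) : set R :=
  [set r | exists2 s : seq (R * R),
             (forall c, c \in s -> I c.1 /\ J c.2)
           & r = \sum_(c <- s) c.1 * c.2].

Definition generator (F : set (set R)) : Prop :=
  [/\ finite_set F, (forall I, F I -> ideal I) & ideal_sum F = setT].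

Definition minimal_generator (F : set (set R)) : Prop :=
  generator F /\ forall G, generator G -> prec F G.

Definition generator_mul (F G : set (set R)) : set (set R) :=
  [set ideal_mul I J | I in F & J in G].

(* [set setT], the family consisting of the unit ideal, is neutral for
   generator_mul on families of ideals. *)
Definition generator_prod (s : seq int) (F : int -> set (set R)) :=
  \big[generator_mul/[set setT]]_(i <- s) F i.

Record ring_aut := RingAut {
  aut_fun :> {rmorphism R -> R};
  aut_invfun : R -> R;
  aut_funK : cancel aut_fun aut_invfun;
  aut_invfunK : cancel aut_invfun aut_fun }.

Definition expansive_aut (alpha : ring_aut) : Prop :=
  exists2 F, generator F &
  forall G, generator G -> exists N : nat,
    prec (generator_prod (int_range N) (fun i => zimage alpha (- i) @` F)) G.

Definition positively_expansive_aut (alpha : ring_aut) : Prop :=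
  exists2 F, generator F &
  forall G, generator G -> exists N : nat,
    prec (generator_prod [seq n%:Z | n <- iota 0 N.+1]
            (fun i => zimage alpha (- i) @` F)) G.

End Algebra.

Section InverseAutomorphism.
Variables (R : comPzRingType) (alpha : ring_aut R).

HB.instance Definition _ := GRing.isZmodMorphism.Build R R (aut_invfun alpha)
  (can2_zmod_morphism (aut_funK alpha) (aut_invfunK alpha)).
HB.instance Definition _ := GRing.isMonoidMorphism.Build R R (aut_invfun alpha)
  (can2_monoid_morphism (aut_funK alpha) (aut_invfunK alpha)).

Definition aut_inv : ring_aut R :=
  @RingAut R (aut_invfun alpha) alpha (aut_invfunK alpha) (aut_funK alpha).

End InverseAutomorphism.

Section Topology.
Variable X : topologicalType.

Definition open_cover (U : set (set X)) : Prop :=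
  [/\ finite_set U, (forall A, U A -> open A) & \bigcup_(A in U) A = setT].

Definition minimal_open_cover (U : set (set X)) : Prop :=
  open_cover U /\ forall V, open_cover V -> prec U V.

Definition cover_meet (U V : set (set X)) : set (set X) :=
  [set A `&` B | A in U & B in V].

Definition cover_wedge (s : seq int) (U : int -> set (set X)) :=
  \big[cover_meet/[set setT]]_(i <- s) U i.

Definition homeomorphism (h : X -> X) : Prop :=
  exists g : X -> X,
    [/\ cancel h g, cancel g h, continuous h & continuous g].

Definition expansive_homeo (h : X -> X) : Prop :=
  homeomorphism h /\
  exists2 U, open_cover U &
  forall V, open_cover V -> exists N : nat,
    prec (cover_wedge (int_range N) (fun i => zimage h (- i) @` U)) V.

Definition positively_expansive_homeo (h : X -> X) : Prop :=
  homeomorphism h /\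
  exists2 U, open_cover U &
  forall V, open_cover V -> exists N : nat,
    prec (cover_wedge [seq n%:Z | n <- iota 0 N.+1]
            (fun i => zimage h (- i) @` U)) V.

End Topology.

Section Spectrum.
Variable R : comPzRingType.

Definition spec : Type := {p : set R | prime_ideal p}.

HB.instance Definition _ := gen_eqMixin spec.
HB.instance Definition _ := gen_choiceMixin spec.

Definition spec_basic (I : set R) : set spec := [set p | ~ (I `<=` sval p)].

Definition zariski : set_system spec :=
  [set A | exists2 I, ideal I & A = spec_basic I].

Lemma zariskiT : zariski setT.
Proof.
exists setT => //; apply/seteqP; split=> // -[p [idp p1 pp]] _ /= sub.
exact/p1/sub.
Qed.

Lemma zariskiI : setI_closed zariski.
Proof.
move=> _ _ [I [I0 ID IM] ->] [J [J0 JD JM] ->]; exists (I `&` J).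
  split=> //; first by move=> x y [? ?] [? ?]; split; [exact: ID | exact: JD].
  by move=> a x [? ?]; split; [exact: IM | exact: JM].
apply/seteqP; split=> -[p [[p0 pD pM] p1 pp]] /=.
  move=> [nI nJ] sub; apply: nI => x Ix; apply: contrapT => npx.
  apply: nJ => y Jy; case: (pp x y) => //; apply: sub.
  by split; [rewrite mulrC; exact: IM | exact: JM].
by move=> nIJ; split=> sub; apply: nIJ => x [Ix Jx]; exact: sub.
Qed.

Lemma zariski_bigU (T : Type) (f : T -> set spec) :
  (forall i, zariski (f i)) -> zariski (\bigcup_i f i).
Proof.
move=> zf; have /choice[I fI] i : exists I, ideal I /\ f i = spec_basic I.
  by have [I idI fI] := zf i; exists I.
pose K := [set x | forall L, ideal L -> (forall i, I i `<=` L) -> L x].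
exists K.
  split=> [L [] //|x y Kx Ky L idL sub|a x Kx L idL sub]; case: (idL) => _ LD LM.
    by apply: LD; [exact: Kx | exact: Ky].
  by apply: LM; exact: Kx.
apply/seteqP; split=> -[p [idp p1 pp]] /=.
  move=> [i _]; rewrite (fI i).2 => nI sub; apply: nI => x Ix.
  by apply: sub => L idL subL; exact: (subL i x Ix).
move=> nK; apply: contrapT => nf; apply: nK => x Kx; apply: Kx => // i.
by apply: contrapT => nI; apply: nf; exists i => //; rewrite (fI i).2.
Qed.

HB.instance Definition _ :=
  isOpenTopological.Build spec zariskiT zariskiI zariski_bigU.

Lemma prime_ideal_preimage (f : {rmorphism R -> R}) (p : set R) :
  prime_ideal p -> prime_ideal (f @^-1` p).
Proof.
move=> [[p0 pD pM] p1 pp]; split; first split.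
- by rewrite /preimage/= rmorph0.
- by move=> x y /= px py; rewrite /preimage/= rmorphD; exact: pD.
- by move=> a x /= px; rewrite /preimage/= rmorphM; exact: pM.
- by rewrite /preimage/= rmorph1.
- by move=> a b; rewrite /preimage/= rmorphM; exact: pp.
Qed.

Definition spec_map (f : {rmorphism R -> R}) (p : spec) : spec :=
  exist _ (f @^-1` sval p) (prime_ideal_preimage f (svalP p)).

End Spectrum.

(* Main.v *)
Require Import Defs.
From HB Require Import structures.
From mathcomp Require Import all_boot all_order all_algebra.
From mathcomp Require Import all_classical topology.

Set Implicit Arguments.
Unset Strict Implicit.
Unset Printing Implicit Defensive.

Import GRing.Theory.
Local Open Scope classical_set_scope.
Local Open Scope ring_scope.

(* An ideal I corresponds to the basic open set U_I; by Krull's theorem a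
   finite family of ideals is a generator exactly when the sets U_I cover the
   spectrum.  Since U_(IJ) is the intersection of U_I and U_J, products of
   generators become meets of covers, and I -> U_I is increasing, so every
   minimality or expansivity property of generators passes to covers.  Finally
   (spec alpha)^i maps U_I to U_(alpha^-i I), which explains the inverse in the
   positively expansive case. *)

(** * Integer iterates of a bijection *)

Lemma iter_cancel (T : Type) (f g : T -> T) (n : nat) :
  cancel f g -> cancel (iter n f) (iter n g).
Proof. by move=> fK; elim: n => // n IH x; rewrite iterSr /= fK IH. Qed.

Lemma zimage_preimage (T : Type) (f g : T -> T) (n : nat) (A : set T) :
  cancel f g -> cancel g f -> zimage f n A = iter n g @^-1` A.
Proof.
move=> fK gK; apply/seteqP; split=> [_ [x Ax <-]|x Ax] /=.
  by rewrite /preimage/= iter_cancel.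
by exists (iter n g x) => //; rewrite iter_cancel.
Qed.

Lemma zimageN_preimage (T : Type) (f : T -> T) (n : nat) (A : set T) :
  zimage f (- n%:Z) A = iter n f @^-1` A.
Proof.
(* At [n = 0] the integer [- 0] is [Posz 0], so [zimage] is an image under the identity there; for
   [n > 0] it is a preimage by definition. *)
case: n => [|n]; rewrite ?oppr0 -?NegzE //=; apply/seteqP.
by split=> [_ [x Ax <-]//|x Ax]; exists x.
Qed.

(** For either sign, both sides are preimages under the same iterates of [f] or of [g], since a
    forward image under a bijection is a preimage under its inverse. *)
Lemma zimageN (T : Type) (f g : T -> T) (i : int) (A : set T) :
  cancel f g -> cancel g f -> zimage f (- i) A = zimage g i A.
Proof.
move=> fK gK; case: i => n.
  by rewrite zimageN_preimage (zimage_preimage _ _ gK fK).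
by rewrite NegzE opprK zimageN_preimage (zimage_preimage _ _ fK gK).
Qed.

(** * Meets of families as a commutative monoid *)

Section CoverMeet.
Variable X : topologicalType.

Lemma cover_meetA : associative (@cover_meet X).
Proof.
move=> U V W; apply/seteqP; split.
  move=> _ [A UA [_ [B VB [C WC <-]] <-]]; exists (A `&` B).
    by exists A => //; exists B.
  by exists C => //; rewrite setIA.
move=> _ [_ [A UA [B VB <-]] [C WC <-]]; exists A => //.
by exists (B `&` C); [exists B => //; exists C | rewrite setIA].
Qed.

Lemma cover_meetC : commutative (@cover_meet X).
Proof.
by move=> U V; apply/seteqP; split=> _ [A UA [B VB <-]];
  exists B => //; exists A => //; rewrite setIC.
Qed.

Lemma cover_meet1 : left_id [set setT] (@cover_meet X).
Proof.
move=> U; apply/seteqP; split=> [_ [_ -> [B UB <-]]|A UA].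
  by rewrite setTI.
by exists setT => //; exists A => //; rewrite setTI.
Qed.

HB.instance Definition _ := Monoid.isComLaw.Build (set (set X)) [set setT]
  (@cover_meet X) cover_meetA cover_meetC cover_meet1.

(** The range is symmetric, so negation permutes the factors of a commutative product. This lets the
    two-sided condition pass from a homeomorphism to its inverse. *)
Lemma cover_wedge_oppr (N : nat) (U : int -> set (set X)) :
  cover_wedge (int_range N) (fun i => U (- i)) = cover_wedge (int_range N) U.
Proof.
have uI : uniq (int_range N).
  by rewrite map_inj_uniq ?iota_uniq // => i j /addIr [].
rewrite /cover_wedge -(big_map -%R xpredT U); apply/perm_big/uniq_perm => //.
  by rewrite map_inj_uniq //; exact: oppr_inj.
have sub i : i \in int_range N -> - i \in int_range N.
  move=> /mapP[k]; rewrite mem_iota /= add0n ltnS => kN ->.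
  (* The witness comes from -(k - N) = (2N - k) - N. *)
  apply/mapP; exists (N.*2 - k)%N.
    by rewrite mem_iota /= add0n ltnS leq_subr.
  by rewrite -subzn // -addnn PoszD opprB addrAC addrK.
move=> i; apply/mapP/idP => [[j Ij ->]|Ii]; first exact: sub.
by exists (- i); [exact: sub | rewrite opprK].
Qed.

End CoverMeet.

(** * Sums of ideals and existence of primes *)

Section Ideals.
Variable R : comPzRingType.
Implicit Types (I J p : set R) (F G : set (set R)).

Lemma ideal_bigsum I (T : eqType) (s : seq T) (x : T -> R) :
  ideal I -> (forall i, i \in s -> I (x i)) -> I (\sum_(i <- s) x i).
Proof.
move=> [I0 ID _] Ix; rewrite big_seq_cond; apply: big_ind => // i.
by rewrite andbT; exact: Ix.
Qed.

Lemma ideal_ideal_mul I J : ideal I -> ideal J -> ideal (ideal_mul I J).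
Proof.
move=> [_ _ IM] _; split; first by exists [::] => //; rewrite big_nil.
  move=> _ _ [s sIJ ->] [t tIJ ->]; exists (s ++ t); last by rewrite big_cat.
  by move=> c; rewrite mem_cat => /orP[/sIJ|/tIJ].
move=> a _ [s sIJ ->]; exists [seq (a * c.1, c.2) | c <- s].
  by move=> _ /mapP[c /sIJ[Ic Jc] ->]; split=> //; exact: IM.
by rewrite big_map big_distrr; apply: eq_bigr => c _; rewrite /= mulrA.
Qed.

Lemma ideal_ideal_sum F :
  finite_set F -> (forall I, F I -> ideal I) -> ideal (ideal_sum F).
Proof.
move=> finF idF; split.
- exists (fun=> 0); first by move=> I /idF[].
  by rewrite fsbig_finite // big1.
- move=> _ _ [x xF ->] [y yF ->]; exists (fun I => x I + y I).
    move=> I FI; have [_ ID _] := idF _ FI.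
    by apply: ID; [exact: xF | exact: yF].
  by rewrite !fsbig_finite // big_split.
- move=> a _ [x xF ->]; exists (fun I => a * x I).
    by move=> I FI; have [_ _ IM] := idF _ FI; apply: IM; exact: xF.
  by rewrite !fsbig_finite // big_distrr.
Qed.

Lemma sub_ideal_sum F I :
  (forall J, F J -> ideal J) -> F I -> I `<=` ideal_sum F.
Proof.
(* The summands are [x] at [I] and 0 elsewhere, so a single term survives. *)
move=> idF FI x Ix; exists (fun J => if J == I then x else 0).
  by move=> J FJ; case: eqP => [->//|_]; have [] := idF _ FJ.
rewrite (fsbigE [:: I]) //=.
- by rewrite big_cons big_nil mem_set // eqxx addr0.
- by move=> J /=; rewrite inE => /eqP->.
- by move=> J _; rewrite inE => /negbTE->.
Qed.

Lemma ideal_sum_sub F p : finite_set F -> ideal p ->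
  (forall I, F I -> I `<=` p) -> ideal_sum F `<=` p.
Proof.
move=> finF idp sub _ [x xF ->]; rewrite fsbig_finite //.
apply: ideal_bigsum => // I; rewrite in_fset_set // inE => FI.
by apply: (sub I FI); exact: xF.
Qed.

(** Zorn's lemma provides a maximal proper ideal containing [I], and maximality makes it prime. *)
Lemma krull I : ideal I -> ~ I 1 -> exists2 p, prime_ideal p & I `<=` p.
Proof.
move=> idI I1.
(* The union with I makes the empty chain admissible in Zorn's lemma. *)
pose P A := ideal (A `|` I) /\ ~ (A `|` I) 1.
have [|A [[idp p1] Amax]] := @Zorn_bigcup _ P.
  move=> C CP totC; case: (idI) => I0 ID IM; split; last first.
    by move=> [[B CB B1]|//]; have [_] := CP _ CB; apply; left.
  have lift B z : C B -> (B `|` I) z -> (\bigcup_(Y in C) Y `|` I) z.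
    by move=> CB [Bz|Iz]; [left; exists B | right].
  split; first by right.
  - move=> x y [[B CB Bx]|Ix] [[D CD Dy]|Iy].
    + have [BD|DB] := totC _ _ CB CD.
        have [[_ DD _] _] := CP _ CD.
        by apply: (lift D) => //; apply: DD; left => //; exact: BD.
      have [[_ BD _] _] := CP _ CB.
      by apply: (lift B) => //; apply: BD; left => //; exact: DB.
    + have [[_ BD _] _] := CP _ CB.
      by apply: (lift B) => //; apply: BD; [left | right].
    + have [[_ DD _] _] := CP _ CD.
      by apply: (lift D) => //; apply: DD; [right | left].
    + by right; exact: ID.
  - move=> a x [[B CB Bx]|Ix]; last by right; exact: IM.
    have [[_ _ BM] _] := CP _ CB.
    by apply: (lift B) => //; apply: BM; left.
(* Zorn's maximality concerns [A] among sets satisfying [P]. If [B] contains [I], joining [I] to it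
   changes nothing, so [P B] says that [B] is a proper ideal. *)
have pmax B : ideal B -> A `|` I `<=` B -> ~ B 1 -> B `<=` A.
  move=> idB AIB B1; apply: contrapT => nBA; apply: (Amax B).
    by split=> // x Ax; apply: AIB; left.
  have -> : P B = (ideal B /\ ~ B 1) => //.
  by rewrite /P (_ : B `|` I = B) //; apply: setUidl => x Ix; apply: AIB; right.
exists (A `|` I); last by move=> x; right.
split=> // a b pab; have [pa|npa] := pselect ((A `|` I) a); first by left.
right; case: (idp) => p0 pD pM.
(* The ideal obtained by adjoining [a]. Were it proper, maximality would put [a] in [A]. *)
pose B := [set z | exists2 x, (A `|` I) x & exists r, z = x + r * a].
have B1 : B 1.
  apply: contrapT => nB1; apply: npa; left; apply: (pmax B) => //.
  - split.
    + by exists 0 => //; exists 0; rewrite mul0r addr0.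
    + move=> _ _ [x px [r ->]] [y py [s ->]]; exists (x + y); first exact: pD.
      by exists (r + s); rewrite mulrDl addrACA.
    + move=> c _ [x px [r ->]]; exists (c * x); first exact: pM.
      by exists (c * r); rewrite mulrDr mulrA.
  - by move=> x px; exists x => //; exists 0; rewrite mul0r addr0.
  - by exists 0 => //; exists 1; rewrite mul1r add0r.
(* From 1 = x + ra follows b = xb + r(ab), with both terms in the ideal. *)
have [x px [r e]] := B1; rewrite -[b]mul1r e mulrDl -mulrA.
by apply: pD; [rewrite mulrC|]; exact: pM.
Qed.

(** * Products and meets, generators and covers *)

Lemma generator_prod_ideal (s : seq int) (H : int -> set (set R)) :
  (forall i I, H i I -> ideal I) ->
  forall I, generator_prod s H I -> ideal I.
Proof.
move=> idH; rewrite /generator_prod; elim: s => [|i s IH] I.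
  by rewrite big_nil => ->.
rewrite big_cons => -[J HJ [K HK <-]].
by apply: ideal_ideal_mul; [exact: idH HJ | exact: IH].
Qed.

(** A prime contains IJ exactly when it contains I or J: if some x in I lies outside p, then xy in p
    forces every y in J into p. *)
Lemma spec_basic_mul I J : ideal I -> ideal J ->
  spec_basic (ideal_mul I J) = spec_basic I `&` spec_basic J.
Proof.
move=> idI idJ; apply/seteqP; split=> -[p [idp p1 pp]] /=; have [_ _ pM] := idp.
  move=> nIJ; split=> sub; apply: nIJ => _ [s sIJ ->];
    apply: ideal_bigsum => // c /sIJ[Ic Jc].
    by rewrite mulrC; apply: pM; exact: sub.
  by apply: pM; exact: sub.
move=> [nI nJ] sub; apply: nI => x Ix; apply: contrapT => npx.
apply: nJ => y Jy; case: (pp x y) => //; apply: sub.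
by exists [:: (x, y)]; [move=> c; rewrite inE => /eqP-> | rewrite big_seq1].
Qed.

Lemma subset_spec_basic I J : I `<=` J -> spec_basic I `<=` spec_basic J.
Proof. by move=> IJ p nI Jp; apply: nI => x /IJ/Jp. Qed.

Lemma spec_basicT : spec_basic setT = [set: spec R].
Proof. by apply/seteqP; split=> // -[p [idp p1 pp]] _ /= sub; exact/p1/sub. Qed.

Lemma cover_wedge_spec (s : seq int) (H : int -> set (set R)) :
  (forall i I, H i I -> ideal I) ->
  cover_wedge s (fun i => @spec_basic R @` H i) =
  @spec_basic R @` generator_prod s H.
Proof.
move=> idH; elim: s => [|i s IH].
  by rewrite /cover_wedge /generator_prod !big_nil image_set1 spec_basicT.
have idP := generator_prod_ideal (s := s) idH.
rewrite /cover_wedge /generator_prod !big_cons.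
rewrite -/(cover_wedge _ _) -/(generator_prod _ _) IH; apply/seteqP; split.
  move=> _ [_ [I HI <-] [_ [J PJ <-] <-]]; exists (ideal_mul I J).
    by exists I => //; exists J.
  by rewrite spec_basic_mul //; [exact: idH HI | exact: idP].
move=> _ [_ [I HI [J PJ <-]] <-]; exists (spec_basic I); first by exists I.
exists (spec_basic J); first by exists J.
by rewrite spec_basic_mul //; [exact: idH HI | exact: idP].
Qed.

(** A prime outside every U_I would contain each I, hence their sum, hence 1. *)
Lemma open_cover_spec_basic F : generator F -> open_cover (@spec_basic R @` F).
Proof.
move=> [finF idF sumF]; split.
- exact: finite_image.
- by move=> _ [I FI <-]; exists I => //; exact: idF.
apply/seteqP; split=> // -[p [idp p1 pp]] _.
apply: contrapT => ncov; apply/p1/(ideal_sum_sub finF idp); last first.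
  by rewrite sumF.
move=> I FI; apply: contrapT => nI; apply: ncov.
by exists (spec_basic I) => //; exists I.
Qed.

(** Pick an ideal for each member of [V]. If their sum were proper, a prime above it would contain
    all of them and lie in no member of the cover. *)
Lemma open_cover_generator (V : set (set (spec R))) : open_cover V ->
  exists2 G, generator G & V = @spec_basic R @` G.
Proof.
move=> [finV openV covV].
(* [choice] needs a value at every set; the guard [V A] leaves it arbitrary outside [V]. *)
have /choice[J JV] A : exists I, V A -> ideal I /\ A = spec_basic I.
  have [/openV[I idI AI]|nVA] := pselect (V A); first by exists I.
  by exists set0.
exists (J @` V); last first.
  apply/seteqP; split=> [A VA|_ [_ [A VA <-] <-]]; last by rewrite -(JV A VA).2.
  by exists (J A); [exists A | rewrite -(JV A VA).2].
have idJ I : (J @` V) I -> ideal I by move=> [A VA <-]; exact: (JV A VA).1.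
have finJ : finite_set (J @` V) by exact: finite_image.
split=> //; have idS := ideal_ideal_sum finJ idJ.
apply/seteqP; split=> // x _.
suff S1 : ideal_sum (J @` V) 1 by rewrite -[x]mulr1; have [_ _] := idS; apply.
apply: contrapT => /(krull idS)[p pp sub].
have : [set: spec R] (exist _ p pp) by [].
rewrite -covV => -[A VA]; rewrite {1}(JV A VA).2; apply.
by apply: subset_trans sub; apply: sub_ideal_sum.
Qed.

Lemma prec_spec_basic F G : prec F G ->
  prec (@spec_basic R @` F) (@spec_basic R @` G).
Proof.
move=> FG _ [I /FG[J GJ IJ] <-]; exists (spec_basic J); first by exists J.
exact: subset_spec_basic.
Qed.

End Ideals.

(** * Automorphisms acting on ideals and on the spectrum *)

Section Automorphisms.
Variables (R : comPzRingType) (alpha : ring_aut R).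

Lemma sval_iter_spec_map n (p : spec R) :
  sval (iter n (spec_map alpha) p) = iter n alpha @^-1` sval p.
Proof.
by elim: n => // n /= ->; apply/seteqP; split=> x; rewrite /preimage/= -iterSr.
Qed.

(** Preimages of ideals under ring morphisms are ideals; a forward image is first rewritten as a
    preimage under the inverse automorphism. *)
Lemma zimage_ideal (i : int) (I : set R) : ideal I -> ideal (zimage alpha i I).
Proof.
have hom (f : {rmorphism R -> R}) n : ideal I -> ideal (iter n f @^-1` I).
  elim: n => // n IH /IH[J0 JD JM]; split.
  - by rewrite /preimage/= -iterS iterSr rmorph0.
  - by move=> x y; rewrite /preimage/= -!iterS !iterSr rmorphD; exact: JD.
  - by move=> a x; rewrite /preimage/= -!iterS !iterSr rmorphM; exact: JM.
move=> idI; case: i => n; last exact: hom.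
rewrite (zimage_preimage _ _ (aut_funK alpha) (aut_invfunK alpha)).
exact: (hom (aut_inv alpha)).
Qed.

End Automorphisms.

Section SpecMap.
Variables (R : comPzRingType) (alpha : ring_aut R).

Lemma spec_mapK : cancel (spec_map alpha) (spec_map (aut_inv alpha)).
Proof.
move=> [p pp]; apply: eq_exist; apply/seteqP.
by split=> x; rewrite /preimage/= aut_invfunK.
Qed.

Lemma spec_map_invK : cancel (spec_map (aut_inv alpha)) (spec_map alpha).
Proof.
move=> [p pp]; apply: eq_exist; apply/seteqP.
by split=> x; rewrite /preimage/= aut_funK.
Qed.

(** Adjunction of image and preimage: I lies in alpha^-n(p) if and only if alpha^n(I) lies in p. *)
Lemma preimage_spec_basic n (I : set R) :
  iter n (spec_map alpha) @^-1` spec_basic I = spec_basic (zimage alpha n I).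
Proof.
apply/seteqP.
split=> p; rewrite /preimage /spec_basic/= sval_iter_spec_map => nI sub;
  apply: nI.
  by move=> x Ix; apply: sub; exists x.
by move=> _ [x Ix <-]; exact: sub.
Qed.

Lemma continuous_spec_map : continuous (spec_map alpha).
Proof.
apply/continuousP => _ [I idI ->].
have -> := preimage_spec_basic 1%N I.
by exists (zimage alpha 1%N I) => //; exact: zimage_ideal.
Qed.

End SpecMap.

(** * Transfer of expansivity to the spectrum *)

Lemma homeomorphism_spec_map (R : comPzRingType) (alpha : ring_aut R) :
  homeomorphism (spec_map alpha).
Proof.
exists (spec_map (aut_inv alpha)); split.
- exact: spec_mapK.
- exact: spec_map_invK.
- exact: continuous_spec_map.
- exact: continuous_spec_map.
Qed.

(** Forward images under spec(alpha^-1) are preimages under spec(alpha), so [preimage_spec_basic]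
    settles both signs, applied to [alpha] or to its inverse. *)
Lemma zimage_spec_basic (R : comPzRingType) (alpha : ring_aut R) (i : int)
    (I : set R) :
  zimage (spec_map (aut_inv alpha)) i (spec_basic I) =
  spec_basic (zimage alpha i I).
Proof.
have K := spec_mapK alpha; have K' := spec_map_invK alpha.
case: i => n.
  by rewrite (zimage_preimage _ _ K' K) preimage_spec_basic.
rewrite NegzE zimageN_preimage preimage_spec_basic.
by rewrite (zimageN _ _ (aut_funK alpha) (aut_invfunK alpha)).
Qed.

(** Leaving the index sequences [s] arbitrary treats the two-sided and the one-sided conditions at
    once. *)
Lemma spec_generator_cover (R : comPzRingType) (alpha : ring_aut R)
    (s : nat -> seq int) :
  (exists2 F, generator F & forall G, generator G -> exists N : nat,
     prec (generator_prod (s N) (fun i => zimage alpha (- i) @` F)) G) ->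
  exists2 U, open_cover U & forall V, open_cover V -> exists N : nat,
    prec (cover_wedge (s N)
            (fun i => zimage (spec_map (aut_inv alpha)) (- i) @` U)) V.
Proof.
move=> [F genF expF]; exists (@spec_basic R @` F).
  exact: open_cover_spec_basic.
move=> _ /open_cover_generator[G /expF[N FG] ->]; exists N.
have [_ idF _] := genF.
have -> : (fun i => zimage (spec_map (aut_inv alpha)) (- i) @`
             (@spec_basic R @` F)) =
          (fun i => @spec_basic R @` (zimage alpha (- i) @` F)).
  apply/funext => i; rewrite !image_comp.
  by apply: eq_imagel => I _ /=; rewrite zimage_spec_basic.
rewrite cover_wedge_spec; first exact: prec_spec_basic.
by move=> i _ [I FI <-]; apply: zimage_ideal; exact: idF.
Qed.

Theorem proposition4p2 (R : comPzRingType) :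
  [/\ (exists F : set (set R), minimal_generator F) ->
        exists U : set (set (spec R)), minimal_open_cover U,
      forall alpha : ring_aut R,
        expansive_aut alpha -> expansive_homeo (spec_map alpha)
    & forall alpha : ring_aut R,
        positively_expansive_aut alpha ->
        positively_expansive_homeo (spec_map (aut_inv alpha))].
Proof.
split.
- move=> [F [genF minF]]; exists (@spec_basic R @` F).
  split; first exact: open_cover_spec_basic.
  by move=> _ /open_cover_generator[G /minF FG ->]; exact: prec_spec_basic.
- move=> alpha /spec_generator_cover[U covU expU].
  split; first exact: homeomorphism_spec_map.
  exists U => // V /expU[N UV]; exists N.
  (* The cover [U] was obtained for spec(alpha^-1). Reversing the symmetric range turns its iterates
     into those of spec(alpha). *)
  rewrite -(cover_wedge_oppr N
    (fun i => zimage (spec_map alpha) (- i) @` U)).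
  have -> // : (fun i => zimage (spec_map alpha) (- - i) @` U) =
               (fun i => zimage (spec_map (aut_inv alpha)) (- i) @` U).
  apply/funext => i; apply: eq_imagel => A _.
  exact: zimageN (spec_mapK alpha) (spec_map_invK alpha).
- move=> alpha /spec_generator_cover expU.
  by split; first exact: homeomorphism_spec_map.
Qed.
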